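(* Let $\mathbf{w}=(w_j)_{j\ge0}$ be a sequence of complex numbers. Write the binary expansion of $n\ge1$ in the following way: $$(n)_2=1^{l_s}0^{l_{s-1}}1^{l_{s-2}}\cdots\overline{a}^{\,l_3}a^{l_2}\,1\,0^{l_1},$$ where $s\ge1$, $l_1\ge0$, $l_i\ge1$ for $i=2,\ldots,s$, and $a\in\{0,1\}$, $\overline{a}=1-a$. Then $$\mathcal{G}_{\mathbf{w}}(n)=(-1)^{\frac{n(n-1)}2}\,w_{l_1}\prod_{i=1}^s\prod_{j=1}^{l_i}\left(w_{k_i}-2^jw_{k_i-j}\right)^{\alpha_{i,j}},$$ where $$k_1=l_1,\qquad k_i=1+\sum_{j=1}^{i}l_j\quad(i\ge2),$$ $$\alpha_{i,j}=2^{k_i-j}\quad\text{if }1\le j<l_i,$$ $$\alpha_{i,l_i}=\begin{cases}1&\text{if }i=1,\\ 2^{l_1+1}&\text{if }i=2,3,\\ 2^{k_{i-2}+1}-\alpha_{i-1,l_{i-1}}&\text{if }i\ge4.\end{cases}$$ In particular, the exponents $\alpha_{i,j}$ are all positive, strictly decreasing with respect to $j=1,\ldots,l_i$ (for each $i$), and satisfy $$1+\sum_{i=1}^s\sum_{j=1}^{l_i}\alpha_{i,j}=n.$$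
   Context: For a sequence of complex weights $\mathbf{w}=(w_j)_{j\ge0}$ and an integer $m\ge0$ with binary expansion $m=\sum_{j=0}^{l}\varepsilon_j2^j$, $\varepsilon_j\in\{0,1\}$, put $s_{\mathbf{w}}(m)=\sum_{j=0}^l w_j\varepsilon_j$ and $d_{\mathbf{w}}(m)=s_{\mathbf{w}}(m+1)-s_{\mathbf{w}}(m)$. For $n\ge1$ let $\mathcal{G}_{\mathbf{w}}(n)=\det[d_{\mathbf{w}}(i+j)]_{0\le i,j<n}$. For a binary digit $b$, $b^l$ denotes the string of $b$ repeated $l$ times. In the displayed decomposition of $(n)_2$ (most significant digit on the left), the rightmost $1$ digit followed by $0^{l_1}$ is separated off, and the remaining prefix is split into maximal alternating runs of lengths $l_s,\ldots,l_2$, the leading run consisting of $1$s; so the run of length $l_i$ ($2\le i\le s$) consists of $1$s if $i\equiv s\pmod 2$ and of $0$s otherwise; the prefix is empty when $s=1$. *)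

(* Defs.v *)
From mathcomp Require Export all_boot all_order all_algebra.
From mathcomp Require Export reals.
From mathcomp Require Export complex.
Set Implicit Arguments.
Unset Strict Implicit.
Unset Printing Implicit Defensive.
Import Order.TTheory GRing.Theory Num.Theory.
Local Open Scope ring_scope.

(* The binary digit of m of weight 2 ^ j. *)
Definition bit (m j : nat) : bool := odd (m %/ 2 ^ j)%N.

(* Most significant digit first, as in (n)_2; equal to [:: false] for n = 0. *)
Definition binary_digits (n : nat) : seq bool :=
  [seq bit n j | j <- rev (iota 0 (trunc_log 2 n).+1)].

Definition digit_sum (C : nzRingType) (w : nat -> C) (m : nat) : C :=
  \sum_(j < (trunc_log 2 m).+1) w j *+ bit m j.

Definition digit_diff (C : nzRingType) (w : nat -> C) (m : nat) : C :=
  digit_sum w m.+1 - digit_sum w m.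

Definition hankel_det (C : comNzRingType) (w : nat -> C) (n : nat) : C :=
  \det (\matrix_(i < n, j < n) digit_diff w (i + j)%N).

(* The digit string  1^{l_s} 0^{l_{s-1}} ... a^{l_2} 1 0^{l_1}, where the value
   l i is the length l_i for 1 <= i <= s (other values of l are not used). *)
Definition run_string (s : nat) (l : nat -> nat) : seq bool :=
  flatten [seq nseq (l i) (odd i == odd s) | i <- rev (iota 2%N s.-1)]
    ++ true :: nseq (l 1%N) false.

Definition run_pos (l : nat -> nat) (i : nat) : nat :=
  if i == 1%N then l 1%N else (1 + \sum_(1 <= j < i.+1) l j)%N.

(* alpha_{i, l_i} for i >= 1 (the value at i = 0 is not used); it is an integer
   so that the subtraction is not truncated. *)
Fixpoint last_exponent (l : nat -> nat) (i : nat) : int :=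
  match i with
  | 0%N | 1%N => 1
  | 2%N | 3%N => 2 ^+ (l 1%N).+1
  | i'.+1 => 2 ^+ (run_pos l i.-2).+1 - last_exponent l i'
  end.

(* alpha_{i, j} for 1 <= j <= l_i. *)
Definition exponent (l : nat -> nat) (i j : nat) : int :=
  if (j < l i)%N then 2 ^+ (run_pos l i - j) else last_exponent l i.

(* Main.v *)
Require Import Defs.
From mathcomp Require Import perm ring zify.
Set Implicit Arguments.
Unset Strict Implicit.
Unset Printing Implicit Defensive.
Import Order.TTheory GRing.Theory Num.Theory.
Local Open Scope ring_scope.

(** Adding 1 to m turns a block of v trailing ones into zeros and the next zero
into a one, so d_w(m) = f(v) with v the 2-adic valuation of m+1 and
f(v) = w_v - (w_0 + ... + w_(v-1)).  The matrix is therefore the Hankel matrix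
of k |-> f(v2(k+1)), which is constant, equal to w_0, at even k; at k = 2j+1 it
is the same sequence at j for the weights w'_k = w_(k+1) - 2^k w_0
([carry_diffS]).

Listing even indices before odd ones puts a Hankel matrix in the form
[cJ, A; A^T, cJ], with c = w_0, J all ones and A the Hankel matrix of the
half-sized problem for w'.  Next to D_n, the determinant, one carries E_n, the
sum of the entries of the adjugate, that is the coefficient of t in
det (H + tJ) = D_n + t E_n.  With D_m, E_m taken for the weights w',
  D_(2m) = (-1)^m (D_m - c E_m) (D_m + c E_m),
  E_(2m) = (-1)^m 2 E_m (D_m - c E_m),
  D_(2m+1) = (-1)^m c F^2,   E_(2m+1) = (-1)^m F^2,
where F is the determinant of the (m+1) x m Hankel matrix bordered by a column
of ones, and the Desnanot-Jacobi identity gives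
F^2 = D_m E_(m+1) - D_(m+1) E_m ([hankel_minor_sqr]).  By induction
([hankel_det_split]), for v = v2(n),
  D_n = (-1)^(n(n-1)/2) w_v Q_n,   E_n = (-1)^(n(n-1)/2) 2^v Q_n,
where Q_1 = 1 and Q_n(w) is one factor w_a - 2^j w_b times
Q_(floor(n/2))(w') Q_(ceil(n/2))(w').  Because w'_k - 2^j w'_(k-j) equals
w_(k+1) - 2^j w_(k+1-j), unfolding this recursion only shifts indices.  After t
halvings n has been split into the 2^t numbers floor((n+c)/2^t), 0 <= c < 2^t,
each equal to q or q+1 where q = floor(n/2^t), and each piece above 1
contributes one factor determined by t and itself ([split_factor]).

It remains to read these factors off the binary expansion.  For t < l_1 all
pieces are equal to q and give w_(l_1) - 2^j w_(l_1-j) with j = l_1 - t; for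
t = l_1 all r_1 = 2^(l_1) pieces give the factor of the second run with j = l_2,
if there is one.  If position t lies in the i-th run, i >= 2, and
t = k_i - j, one of q, q+1 is an odd multiple of 2^j and gives
w_(k_i) - 2^j w_(k_i-j); the other one gives the factor belonging to j-1, or, if
j = 1, the factor of the next run with j = l_(i+1) ([level_prod_run]), if there
is a next run.  How many of the 2^t pieces are of the second kind does not
depend on t inside the run; this number r_i ([run_offset]) satisfies
r_2 = r_1 and r_i + r_(i-1) = 2^(k_(i-1)) for i >= 3.  Regrouping equal factors
gives exponent 2^(k_i-j) for j < l_i and 2 r_(i-1) for j = l_i with i >= 2, which
is the recursion for alpha.  The exponents of the first i >= 2 runs add up, with
the extra 1, to 2^(k_i) - r_i ([sum_run_exponent]), and this is n when i = s. *)

(** * Block determinants and the sum of the adjugate entries *)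

(** The Schur complement formula cleared of denominators: multiply on the right by
the block triangular matrix [1, - adj A B; 0, det A]. *)
Lemma det_block_adj_weak (R : comNzRingType) m k (A : 'M[R]_m) (B : 'M_(m, k))
    (C : 'M_(k, m)) (D : 'M_k) :
  \det (block_mx A B C D) * \det A ^+ k =
    \det A * \det (\det A *: D - C *m \adj A *m B).
Proof.
have eqM : block_mx A B C D *m block_mx 1%:M (- (\adj A *m B)) 0 (\det A)%:M =
    block_mx A 0 C (\det A *: D - C *m \adj A *m B).
  rewrite mulmx_block !mulmx1 !mulmx0 !addr0 !mulmxN !mulmxA mul_mx_adj.
  by rewrite mul_scalar_mx !mul_mx_scalar addNr [- _ + _]addrC.
by have := congr1 determinant eqM; rewrite det_mulmx det_ublock det_lblock
  det1 mul1r det_scalar.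
Qed.

(** Cancelling det A is legitimate when A is replaced by A + X over the polynomial
ring, where the determinant is monic; evaluate at X = 0 afterwards. *)
Lemma det_block_adj (R : idomainType) m k (A : 'M[R]_m) (B : 'M_(m, k.+1))
    (C : 'M_(k.+1, m)) (D : 'M_k.+1) :
  \det (block_mx A B C D) * \det A ^+ k =
    \det (\det A *: D - C *m \adj A *m B).
Proof.
pose ev : {rmorphism {poly R} -> R} := horner_eval (0 : R).
have evC p q (M : 'M[R]_(p, q)) : map_mx ev (map_mx polyC M) = M.
  by apply/matrixP=> i j; rewrite !mxE /= /horner_eval hornerC.
pose Ax := char_poly_mx (- A).
have evA : map_mx ev Ax = A.
  apply/matrixP=> i j; rewrite !mxE /= /horner_eval.
  by rewrite hornerD hornerMn hornerX hornerN hornerC mul0rn add0r opprK.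
have Ax_neq0 : \det Ax != 0 by rewrite monic_neq0 // char_poly_monic.
have := det_block_adj_weak Ax (map_mx polyC B) (map_mx polyC C) (map_mx polyC D).
rewrite exprS mulrCA => /(mulfI Ax_neq0) /(congr1 ev).
rewrite rmorphM rmorphXn /= -!det_map_mx map_block_mx !evC evA.
by rewrite map_mxB map_mxZ !map_mxM map_mx_adj !evC evA -det_map_mx evA.
Qed.

(** 1^T adj A 1, the derivative of the determinant in the direction of the all-ones
matrix; keeping it next to the determinant is what makes the recursion close. *)
Definition adj_sum (R : comNzRingType) m (A : 'M[R]_m) : R :=
  \sum_i \sum_j (\adj A) i j.

Lemma adj_sumE (R : comNzRingType) m (A : 'M[R]_m) :
  const_mx 1 *m \adj A *m const_mx 1 = (adj_sum A)%:M :> 'M_1.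
Proof.
apply/matrixP=> i j; rewrite !ord1 !mxE eqxx mulr1n /adj_sum exchange_big /=.
apply: eq_bigr => k _; rewrite !mxE mulr1; apply: eq_bigr => k' _.
by rewrite !mxE mul1r.
Qed.

(** The all-ones matrix has rank one, so the determinant is affine in t. *)
Lemma det_add_const (R : idomainType) m (A : 'M[R]_m) t :
  \det (A + const_mx t) = \det A + t * adj_sum A.
Proof.
pose u : 'M[R]_(m, 1) := const_mx 1.
pose v : 'M[R]_(1, m) := const_mx 1.
have uv : t *: u *m v = const_mx t.
  by apply/matrixP=> i j; rewrite !mxE big_ord1 !mxE !mulr1.
have := det_block_adj A (- (t *: u)) v 1%:M.
have -> : \det (block_mx A (- (t *: u)) v 1%:M) = \det (A + const_mx t).
  have : block_mx A (- (t *: u)) v 1%:M *m block_mx 1%:M 0 (- v) 1%:M =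
      block_mx (A + const_mx t) (- (t *: u)) 0 1%:M.
    rewrite mulmx_block !mulmx1 !mulmx0 !mul1mx !add0r subrr.
    by rewrite mulNmx mulmxN opprK uv.
  move/(congr1 determinant).
  by rewrite det_mulmx det_lblock det_ublock !det1 !mulr1.
rewrite expr0 mulr1 => ->.
rewrite mulmxN opprK -scalemxAr adj_sumE.
by rewrite det_mx11 !mxE eqxx !mulr1n mulr1.
Qed.

Lemma adj_sum_add_const (R : idomainType) m (A : 'M[R]_m) t :
  adj_sum (A + const_mx t) = adj_sum A.
Proof.
have := det_add_const (A + const_mx t) 1.
have -> : A + const_mx t + const_mx 1 = A + const_mx (t + 1).
  by apply/matrixP=> i j; rewrite !mxE addrA.
rewrite !det_add_const mul1r mulrDl mul1r addrA.
by move/addrI.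
Qed.

Lemma det_block_swap (R : comNzRingType) m (P Q : 'M[R]_m) :
  \det (block_mx P Q Q P) = \det (P + Q) * \det (P - Q).
Proof.
have : block_mx 1%:M 1%:M 0 1%:M *m block_mx P Q Q P *m
    block_mx 1%:M (- 1%:M) 0 1%:M = block_mx (P + Q) 0 Q (P - Q).
  rewrite !mulmx_block !mulmx1 !mulmx0 !mul1mx !mul0mx !mulmxN !mulmx1 !addr0 !add0r.
  rewrite [- (P + Q) + _]addrC [Q + P]addrC subrr [- Q + P]addrC.
  by [].
by move/(congr1 determinant); rewrite !det_mulmx !det_ublock det_lblock !det1
  !mul1r mulr1.
Qed.

(** With K = [A | 1], the matrix is diag(K, 1) X diag(K^T, 1), where X has blocks
[diag(0, c), I0; I0^T, cJ] and I0 selects the columns of A in K. *)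
Lemma det_block_const_border (R : comNzRingType) m (A : 'M[R]_(m + 1, m)) c :
  \det (block_mx (const_mx c) A A^T (const_mx c)) =
    (-1) ^+ m * c * \det (row_mx A (const_mx 1)) ^+ 2.
Proof.
pose K : 'M[R]_(m + 1) := row_mx A (const_mx 1).
pose I0 : 'M[R]_(m + 1, m) := col_mx 1%:M 0.
pose J : 'M[R]_m := const_mx c.
pose Cc : 'M[R]_(m + 1) := block_mx 0 0 0 c%:M.
pose X := block_mx Cc I0 I0^T J.
have KI0 : K *m I0 = A by rewrite mul_row_col mulmx1 mulmx0 addr0.
have fact : block_mx (const_mx c) A A^T J =
    block_mx K 0 0 1%:M *m X *m block_mx K^T 0 0 1%:M.
  rewrite !mulmx_block !mulmx0 !mul0mx !mulmx1 !mul1mx !addr0 !add0r KI0.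
  rewrite -trmx_mul KI0; congr block_mx.
  rewrite mul_row_block !mulmx0 !addr0 tr_row_mx add0r mul_row_col mul0mx add0r.
  by apply/matrixP=> i j; rewrite !mxE big_ord1 !mxE big_ord1 !mxE eqxx mul1r mulr1.
have detX : \det X = (-1) ^+ m * c.
  have : block_mx 1%:M 0 (- I0^T) 1%:M *m (block_mx 1%:M I0 0 1%:M *m X) =
      block_mx (block_mx 1%:M 0 0 c%:M) (I0 + I0 *m J) 0 (- 1%:M).
    rewrite !mulmx_block !mul0mx !mul1mx !addr0 !add0r.
    have -> : Cc + I0 *m I0^T = block_mx 1%:M 0 0 c%:M.
      rewrite tr_col_mx trmx1 trmx0 mul_col_row !mulmx0 !mul0mx !mulmx1.
      by rewrite add_block_mx !add0r addr0.
    have trI : I0^T = row_mx 1%:M 0 by rewrite tr_col_mx trmx1 trmx0.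
    have -> : - I0^T *m block_mx 1%:M 0 0 c%:M + I0^T = 0.
      rewrite mulNmx {1}trI mul_row_block !mulmx0 !mul0mx mul1mx !addr0.
      by rewrite trI addNr.
    congr block_mx; rewrite mulmxDr !mulNmx mulmxA.
    have -> : I0^T *m I0 = 1%:M.
      by rewrite trI mul_row_col mulmx1 mul0mx addr0.
    by rewrite mul1mx subrK.
  move/(congr1 determinant).
  rewrite !det_mulmx !det_ublock !det_lblock !det1 !mul1r => ->.
  by rewrite -scaleN1r detZ det1 det_scalar1 mulr1 mulrC.
rewrite fact !det_mulmx detX !det_lblock !det1 det_tr /K; ring.
Qed.

(** * The Desnanot-Jacobi identity for Hankel matrices *)

Definition hankel (C : Type) (a : nat -> C) m n : 'M[C]_(m, n) :=
  \matrix_(i < m, j < n) a (i + j)%N.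

(** The column of ones makes this minor insensitive to adding a constant to a. *)
Definition hankel_minor (R : comNzRingType) (a : nat -> R) m : R :=
  \det (row_mx (hankel a (m + 1) m) (const_mx 1)).

Lemma det_block_scalar1 (R : idomainType) (x y z t : R) :
  \det (block_mx x%:M y%:M z%:M (t%:M : 'M_1)) = x * t - z * y.
Proof.
have adj1 : \adj (x%:M : 'M[R]_1) = 1%:M.
  by apply/matrixP=> i j; rewrite !mxE !ord1 /cofactor det_mx00 mulr1.
have := det_block_adj (x%:M : 'M[R]_1) y%:M z%:M (t%:M : 'M_1).
rewrite expr0 mulr1 => ->; rewrite adj1 mulmx1 det_scalar1 -scalar_mxM.
by rewrite det_mx11 !mxE eqxx !mulr1n.
Qed.

(** Border the Hankel matrix of order m by its next row and column and by a row and
column of ones, and compute the resulting determinant of order m + 2 by the Schur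
complement of the m x m block. The complement is symmetric of order 2, with the
determinant of order m + 1 and minus the adjugate sum of order m on the diagonal
and the minor off the diagonal. *)
Lemma hankel_minor_sqr (R : idomainType) (a : nat -> R) m :
  hankel_minor a m ^+ 2 =
    \det (hankel a m m) * adj_sum (hankel a m.+1 m.+1)
    - \det (hankel a m.+1 m.+1) * adj_sum (hankel a m m).
Proof.
pose A := hankel a m m.
pose b : 'M[R]_(m, 1) := \matrix_(i, j) a (i + m)%N.
pose c : 'M[R]_1 := const_mx (a (m + m)%N).
pose u : 'M[R]_(m, 1) := const_mx 1.
have trA : A^T = A by apply/matrixP=> i j; rewrite !mxE addnC.
have trAA : \adj A = (\adj A)^T by rewrite trmx_adj trA.
have tr1 (M : 'M[R]_1) : M^T = M by apply/matrixP=> i j; rewrite !mxE !ord1.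
have shift_ord (i : 'I_1) : (nat_of_ord i = 0)%N by rewrite ord1.
have leq_ord1 (k : 'I_(m + 1)) : (k <= m)%N by have := ltn_ord k; lia.
have ltm1 : (m + 1 <= m)%N = false by lia.
have D1 : \det (hankel a m.+1 m.+1) = (\det A *: c - b^T *m \adj A *m b) 0 0.
  rewrite -det_mx11 -det_block_adj expr0 mulr1 -addn1; congr (\det _).
  apply/matrixP=> i j; rewrite -(splitK i) -(splitK j).
  case: (split i) => i'; case: (split j) => j' /=;
    rewrite ?block_mxEul ?block_mxEur ?block_mxEdl ?block_mxEdr !mxE /=
      ?shift_ord ?addn0 //.
  by rewrite addnC.
have F1 : hankel_minor a m = (\det A *: 1%:M - b^T *m \adj A *m u) 0 0.
  rewrite -det_mx11 -det_block_adj expr0 mulr1 block_mxEh /hankel_minor.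
  congr (\det (row_mx _ _)).
    apply/matrixP=> i j; rewrite -(splitK i); case: (split i) => i' /=.
      by rewrite col_mxEu !mxE.
    by rewrite col_mxEd !mxE /= shift_ord addn0 addnC.
  apply/matrixP=> i j; rewrite -(splitK i); case: (split i) => i' /=.
    by rewrite col_mxEu !mxE.
  by rewrite col_mxEd !mxE !ord1.
have E1 : u^T *m \adj A *m u = (adj_sum A)%:M.
  by rewrite -adj_sumE trmx_const.
have E2 k : k = m.+1 -> \det (block_mx (hankel a k k) (const_mx 1) (const_mx 1)
    (0 : 'M_1)) = - adj_sum (hankel a m.+1 m.+1).
  move=> ->.
  have := det_block_adj (hankel a m.+1 m.+1) (const_mx 1) (const_mx 1) (0 : 'M_1).
  rewrite expr0 mulr1 scaler0 sub0r adj_sumE det_mx11 !mxE eqxx mulr1n => ->.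
  by [].
pose N : 'M[R]_(1 + 1) := block_mx c 1%:M 1%:M 0.
have : \det (block_mx A (row_mx b u) (col_mx b^T u^T) N) * \det A ^+ 1 =
    \det (\det A *: N - col_mx b^T u^T *m \adj A *m row_mx b u).
  exact: (det_block_adj A (row_mx b u) (col_mx b^T u^T) N).
rewrite /N.
have -> : \det (block_mx A (row_mx b u) (col_mx b^T u^T) (block_mx c 1%:M 1%:M 0)) =
    - adj_sum (hankel a m.+1 m.+1).
  rewrite -(E2 _ (addn1 m)).
  (* This matrix can be cut both as m + (1 + 1) and as (m + 1) + 1. *)
  pose h i j := if (i <= m)%N && (j <= m)%N then a (i + j)%N
    else if (i <= m)%N || (j <= m)%N then 1 else 0.
  transitivity (\det (\matrix_(i < m + (1 + 1), j < m + (1 + 1)) h i j)).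
    congr (\det _); apply/matrixP=> i j.
    rewrite -(splitK i) -(splitK j).
    case: (split i) => i'; case: (split j) => j' /=;
      rewrite ?block_mxEul ?block_mxEur ?block_mxEdl ?block_mxEdr !mxE /= /h /=.
    - by rewrite !(ltnW (ltn_ord _)).
    - rewrite (ltnW (ltn_ord _)) /=; case: splitP => k; rewrite !mxE => ->.
        by rewrite shift_ord addn0 leqnn.
      by rewrite shift_ord addn0 addn1 ltnn.
    - rewrite (ltnW (ltn_ord _)) /=; case: splitP => k; rewrite !mxE => ->.
        by rewrite shift_ord addn0 leqnn addnC.
      by rewrite shift_ord addn0 addn1 ltnn.
    case: splitP => k; rewrite !mxE => ->; case: splitP => k'; rewrite !mxE => ->;
      by rewrite !shift_ord ?addn0 ?addn1 ?leqnn ?ltnn //= !ord1.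
  rewrite addnA; congr (\det _); apply/matrixP=> i j.
  rewrite -(splitK i) -(splitK j).
  case: (split i) => i'; case: (split j) => j' /=;
    rewrite ?block_mxEul ?block_mxEur ?block_mxEdl ?block_mxEdr !mxE /= /h /=
     ?shift_ord ?addn0 ?addn1 ?ltnn ?andbF ?orbF //.
  - by rewrite !leq_ord1.
  - by rewrite leq_ord1 ltm1.
  by rewrite leq_ord1 ltm1.
rewrite mul_col_mx mul_col_row expr1 scale_block_mx opp_block_mx add_block_mx.
rewrite scaler0 sub0r E1.
have -> : u^T *m \adj A *m b = b^T *m \adj A *m u.
  by rewrite -[LHS]tr1 !trmx_mul trmxK -trAA mulmxA.
rewrite [X in block_mx X]mx11_scalar -D1.
rewrite [X in block_mx _ X]mx11_scalar -F1.
rewrite [X in block_mx _ _ X]mx11_scalar -F1.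
set x := \det _; set y := hankel_minor _ _; set e := adj_sum A.
have -> : - (e%:M : 'M[R]_1) = (- e)%:M by apply/matrixP=> i j; rewrite !mxE mulNrn.
rewrite det_block_scalar1; set d := \det _; set e' := adj_sum _ => H.
have -> : y ^+ 2 = d * - e - (d * - e - y * y) by ring.
by rewrite -H; ring.
Qed.

(** * Parity splitting of Hankel determinants *)

(** The same permutation acts on rows and columns, so its sign cancels. *)
Lemma det_parity_split (R : comNzRingType) (h : nat -> nat -> R) p q :
  (q <= p <= q.+1)%N ->
  \det (\matrix_(i < p + q, j < p + q) h i j) =
  \det (block_mx (\matrix_(i < p, j < p) h i.*2 j.*2)
                 (\matrix_(i < p, j < q) h i.*2 j.*2.+1)
                 (\matrix_(i < q, j < p) h i.*2.+1 j.*2)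
                 (\matrix_(i < q, j < q) h i.*2.+1 j.*2.+1)).
Proof.
move=> /andP[le_qp le_pq].
pose f k := if (k < p)%N then k.*2 else (k - p).*2.+1.
have f_lt (k : 'I_(p + q)) : (f k < p + q)%N.
  by have := ltn_ord k; rewrite /f; case: ifP; lia.
pose F (k : 'I_(p + q)) := Ordinal (f_lt k).
have F_inj : injective F.
  move=> k k' /(congr1 val) /=; rewrite /f => E; apply/val_inj => /=.
  by move: E; case: ifP; case: ifP; lia.
pose s := perm F_inj.
set H := \matrix_(i, j) _.
transitivity (\det (row_perm s (col_perm s H))).
  rewrite row_permE col_permE !det_mulmx !det_perm odd_permV.
  by rewrite mulrCA -signr_addb addbb mulr1.
congr (\det _); apply/matrixP=> i j; rewrite -(splitK i) -(splitK j).
by case: (split i) => i'; case: (split j) => j' /=;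
  rewrite ?block_mxEul ?block_mxEur ?block_mxEdl ?block_mxEdr !mxE !permE /= /f
    ?ltn_ord // ?[in X in h X _](ltnNge _ p) ?[in X in h _ X](ltnNge _ p)
    ?leq_addr /= ?addKn.
Qed.

Lemma hankel_add_const (R : pzRingType) (a : nat -> R) t m n :
  hankel (fun k => a k + t) m n = hankel a m n + const_mx t.
Proof. by apply/matrixP=> i j; rewrite !mxE. Qed.

(** Adjugate sums are first differences of determinants in the additive constant; the
recursion for them follows in this way from the one for determinants. *)
Lemma adj_sum_hankel (R : idomainType) (a : nat -> R) m :
  adj_sum (hankel a m m) =
    \det (hankel (fun k => a k + 1) m m) - \det (hankel a m m).
Proof. by rewrite hankel_add_const det_add_const mul1r addrC addKr. Qed.

Lemma hankel_minor_add_const (R : comNzRingType) (a : nat -> R) t m :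
  hankel_minor (fun k => a k + t) m = hankel_minor a m.
Proof.
rewrite /hankel_minor hankel_add_const.
have -> : row_mx (hankel a (m + 1) m + const_mx t) (const_mx 1) =
   row_mx (hankel a (m + 1) m) (const_mx 1 : 'cV_(m + 1)) *m
   (block_mx 1%:M 0 (const_mx t) 1%:M : 'M_(m + 1)).
  rewrite mul_row_block !mulmx1 mulmx0 add0r; congr (row_mx (_ + _) _).
  by apply/matrixP=> i j; rewrite !mxE big_ord1 !mxE mul1r.
by rewrite det_mulmx det_lblock !det1 !mulr1.
Qed.

Section ParityRecursion.
Variables (R : idomainType) (a : nat -> R) (c : R).
Hypothesis a_even : forall k, a k.*2 = c.
Let g k := a k.*2.+1.

Lemma det_hankel_double m :
  \det (hankel a (m + m) (m + m)) = (-1) ^+ m *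
    (\det (hankel g m m) - c * adj_sum (hankel g m m)) *
    (\det (hankel g m m) + c * adj_sum (hankel g m m)).
Proof.
rewrite (det_parity_split (fun i j => a (i + j)%N)); last by rewrite leqnn leqnSn.
have -> : \matrix_(i < m, j < m) a (i.*2 + j.*2)%N = const_mx c.
  by apply/matrixP=> i j; rewrite !mxE -doubleD a_even.
have -> : \matrix_(i < m, j < m) a (i.*2.+1 + j.*2.+1)%N = const_mx c.
  by apply/matrixP=> i j; rewrite !mxE addSn addnS -doubleD -doubleS a_even.
have -> : \matrix_(i < m, j < m) a (i.*2 + j.*2.+1)%N = hankel g m m.
  by apply/matrixP=> i j; rewrite !mxE addnS -doubleD.
have -> : \matrix_(i < m, j < m) a (i.*2.+1 + j.*2)%N = hankel g m m.
  by apply/matrixP=> i j; rewrite !mxE addSn -doubleD.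
rewrite det_block_swap addrC det_add_const mulrC; congr (_ * _).
rewrite -[const_mx c - _]opprB -scaleN1r detZ; congr (_ * _).
have -> : - const_mx c = const_mx (- c) :> 'M[R]_m.
  by apply/matrixP=> i j; rewrite !mxE.
by rewrite det_add_const mulNr.
Qed.

Lemma det_hankel_doubleS m :
  \det (hankel a (m + 1 + m) (m + 1 + m)) =
    (-1) ^+ m * c * hankel_minor g m ^+ 2.
Proof.
rewrite (det_parity_split (fun i j => a (i + j)%N)); last by rewrite addn1 leqnn leqnSn.
have -> : \matrix_(i < m + 1, j < m + 1) a (i.*2 + j.*2)%N = const_mx c.
  by apply/matrixP=> i j; rewrite !mxE -doubleD a_even.
have -> : \matrix_(i < m, j < m) a (i.*2.+1 + j.*2.+1)%N = const_mx c.
  by apply/matrixP=> i j; rewrite !mxE addSn addnS -doubleD -doubleS a_even.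
have -> : \matrix_(i < m + 1, j < m) a (i.*2 + j.*2.+1)%N = hankel g (m + 1) m.
  by apply/matrixP=> i j; rewrite !mxE addnS -doubleD.
have -> : \matrix_(i < m, j < m + 1) a (i.*2.+1 + j.*2)%N = (hankel g (m + 1) m)^T.
  by apply/matrixP=> i j; rewrite !mxE addSn -doubleD addnC.
exact: det_block_const_border.
Qed.

End ParityRecursion.

Lemma adj_sum_hankel_double (R : idomainType) (a : nat -> R) c m :
    (forall k, a k.*2 = c) -> let g k := a k.*2.+1 in
  adj_sum (hankel a (m + m) (m + m)) = (-1) ^+ m * 2 *
    adj_sum (hankel g m m) * (\det (hankel g m m) - c * adj_sum (hankel g m m)).
Proof.
move=> a_even g; rewrite adj_sum_hankel (det_hankel_double a_even).
have -> := det_hankel_double (a := fun k => a k + 1) (c := c + 1).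
  rewrite (hankel_add_const g) det_add_const adj_sum_add_const -/g; ring.
by move=> k; rewrite a_even.
Qed.

Lemma adj_sum_hankel_doubleS (R : idomainType) (a : nat -> R) c m :
    (forall k, a k.*2 = c) -> let g k := a k.*2.+1 in
  adj_sum (hankel a (m + 1 + m) (m + 1 + m)) =
    (-1) ^+ m * hankel_minor g m ^+ 2.
Proof.
move=> a_even g; rewrite adj_sum_hankel (det_hankel_doubleS a_even).
have -> := det_hankel_doubleS (a := fun k => a k + 1) (c := c + 1).
  rewrite (hankel_minor_add_const g) -/g; ring.
by move=> k; rewrite a_even.
Qed.

(** * Weighted digit sums and the halving recursion *)

(** The value of the digit difference at any m with v trailing ones. *)
Definition carry_diff (R : pzRingType) (w : nat -> R) (v : nat) : R :=
  w v - \sum_(j < v) w j.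

(** Halving the matrix replaces the weights w by these. *)
Definition next_weight (R : pzRingType) (w : nat -> R) (k : nat) : R :=
  w k.+1 - 2 ^+ k * w 0%N.

Lemma bitS m j : bit m j.+1 = bit m./2 j.
Proof. by rewrite /bit expnS divnMA divn2. Qed.

Lemma bit_large m j : (m < 2 ^ j)%N -> bit m j = false.
Proof. by move=> lt_m; rewrite /bit divn_small. Qed.

Lemma digit_sum_widen (R : nzRingType) (w : nat -> R) m N : (m < 2 ^ N)%N ->
  digit_sum w m = \sum_(j < N) w j *+ bit m j.
Proof.
move=> lt_m; rewrite /digit_sum.
have widen p q : (m < 2 ^ p)%N -> (p <= q)%N ->
    \sum_(j < p) w j *+ bit m j = \sum_(j < q) w j *+ bit m j.
  move=> lt_p le_pq; rewrite (big_ord_widen q (fun j => w j *+ bit m j) le_pq).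
  rewrite [RHS](bigID (fun j : 'I_q => (j < p)%N)) /= [X in _ = _ + X]big1 ?addr0 //.
  move=> j; rewrite -leqNgt => le_pj; rewrite bit_large ?mulr0n //.
  by rewrite (leq_trans lt_p) // leq_exp2l.
have lt_log : (m < 2 ^ (trunc_log 2 m).+1)%N by exact: trunc_log_ltn.
by case: (leqP (trunc_log 2 m).+1 N) => [/widen|/ltnW /widen] -> //.
Qed.

Lemma digit_sum_half (R : nzRingType) (w : nat -> R) m :
  digit_sum w m = w 0%N *+ odd m + digit_sum (fun k => w k.+1) m./2.
Proof.
rewrite (@digit_sum_widen _ w m m.+1); last by rewrite ltnW // ltn_expl.
rewrite (@digit_sum_widen _ _ m./2 m); last first.
  by apply: leq_ltn_trans (ltn_expl m (ltnSn 1)); rewrite -divn2 leq_div.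
rewrite big_ord_recl {1}/bit /= expn0 divn1; congr (_ + _).
by apply: eq_bigr => j _; rewrite /bump /= add1n bitS.
Qed.

Lemma logn2_odd m : odd m -> logn 2 m = 0%N.
Proof. by move=> odd_m; apply/eqP; rewrite lognE dvdn2 odd_m /= andbF. Qed.

Lemma logn2_double m : (0 < m)%N -> logn 2 m.*2 = (logn 2 m).+1.
Proof. by move=> m_gt0; rewrite -mul2n lognM // logn_prime. Qed.

Lemma digit_diffE (R : nzRingType) (w : nat -> R) m :
  digit_diff w m = carry_diff w (logn 2 m.+1).
Proof.
have [k] := ubnP m; elim: k => // k IHk in w m *; rewrite ltnS => le_mk.
have := odd_double_half m; case: (boolP (odd m)) => odd_m /=;
  rewrite ?add0n ?add1n => Em.
  have half_lt : (m./2 < k)%N by lia.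
  have Em1 : m.+1 = (m./2.+1).*2 by rewrite -{1}Em doubleS.
  have -> : digit_diff w m = digit_diff (fun j => w j.+1) m./2 - w 0%N.
    rewrite /digit_diff !(digit_sum_half w) Em1 odd_double odd_m doubleK /=.
    rewrite mulr0n mulr1n add0r.
    by rewrite opprD addrA addrAC.
  rewrite Em1 logn2_double // IHk // /carry_diff big_ord_recl /= opprD addrA.
  by rewrite addrAC.
rewrite logn2_odd /= ?odd_m // /digit_diff !(digit_sum_half w) /= odd_m.
have -> : uphalf m = m./2 by rewrite uphalf_half (negbTE odd_m).
by rewrite (negbTE odd_m) /= mulr1n mulr0n add0r addrK /carry_diff big_ord0 subr0.
Qed.

Lemma carry_diffS (R : comPzRingType) (w : nat -> R) v :
  carry_diff w v.+1 = carry_diff (next_weight w) v.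
Proof.
rewrite /carry_diff /next_weight.
elim: v => [|v IHv].
  by rewrite big_ord1 big_ord0 expr0 mul1r subr0.
move: IHv; rewrite !big_ord_recr /= exprS.
set S := \sum_(_ < _) _; set S' := \sum_(_ < _) _ => H.
have -> : S' = w v.+1 - 2 ^+ v * w 0%N - (w v.+1 - 2 ^+ v * w 0%N - S') by ring.
by rewrite -H; ring.
Qed.

(** The factor contributed by a piece x after t halvings. For odd x = 2y + 1 exactly
one of y and y + 1 is even, so the valuation of y(y + 1) is that of the even one. *)
Definition split_factor (R : pzRingType) (w : nat -> R) (t x : nat) : R :=
  if (x <= 1)%N then 1
  else if odd x then
    let v := logn 2 (x./2 * x./2.+1) in w (v.+1 + t)%N - 2 ^+ v * w t.+1
  else let v := logn 2 x in w (v + t)%N - 2 ^+ v * w t.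

(** Halving n repeatedly, rounding down and up, splits it after t steps into the
numbers floor((n + c) / 2^t) with c < 2^t. *)
Definition split_prod (R : comPzRingType) (w : nat -> R) N n : R :=
  \prod_(t < N) \prod_(c < 2 ^ t) split_factor w t ((n + c) %/ 2 ^ t).

(** The expressions w_(k+j) - 2^j w_k keep their form when w is replaced by the next
weights, because the contributions of w_0 cancel. *)
Lemma split_factorS (R : comPzRingType) (w : nat -> R) t x :
  split_factor w t.+1 x = split_factor (next_weight w) t x.
Proof.
rewrite /split_factor /next_weight; case: ifP => // _.
by case: ifP => _ /=; rewrite !addnS ?addSn ?exprS exprD; ring.
Qed.

Lemma prod_ord_exp2S (R : comPzRingType) (F : nat -> R) t :
  \prod_(c < 2 ^ t.+1) F c = \prod_(c < 2 ^ t) (F c.*2 * F c.*2.+1).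
Proof.
rewrite expnS mul2n; move: (2 ^ t)%N => n.
elim: n => [|n IHn]; first by rewrite !big_ord0.
by rewrite doubleS !big_ord_recr /= IHn mulrA.
Qed.

Lemma split_prod_double (R : comPzRingType) (w : nat -> R) N m :
  split_prod w N.+1 m.*2 =
    split_factor w 0 m.*2 * split_prod (next_weight w) N m ^+ 2.
Proof.
rewrite /split_prod big_ord_recl /= expn0 big_ord_recl big_ord0 mulr1 divn1 addn0.
congr (_ * _); rewrite expr2 -big_split /=; apply: eq_bigr => t _.
rewrite (prod_ord_exp2S (fun c => split_factor w t.+1 ((m.*2 + c) %/ 2 ^ t.+1))).
rewrite -big_split /=; apply: eq_bigr => c _.
rewrite expnS addnS -doubleD !divnMA !divn2 doubleK -uphalfE uphalf_double.
by rewrite !split_factorS.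
Qed.

Lemma split_prod_doubleS (R : comPzRingType) (w : nat -> R) N m :
  split_prod w N.+1 m.*2.+1 = split_factor w 0 m.*2.+1 *
    (split_prod (next_weight w) N m * split_prod (next_weight w) N m.+1).
Proof.
rewrite /split_prod big_ord_recl /= expn0 big_ord_recl big_ord0 mulr1 divn1 addn0.
congr (_ * _); rewrite -big_split /=; apply: eq_bigr => t _.
rewrite (prod_ord_exp2S (fun c => split_factor w t.+1 ((m.*2.+1 + c) %/ 2 ^ t.+1))).
rewrite -big_split /=; apply: eq_bigr => c _.
rewrite expnS addnS !addSn -doubleD !divnMA !divn2 -doubleS doubleK -uphalfE.
rewrite uphalf_double.
by rewrite !split_factorS.
Qed.

Lemma split_prod1 (R : comPzRingType) (w : nat -> R) N : split_prod w N 1 = 1.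
Proof.
rewrite /split_prod big1 // => t _; rewrite big1 // => c _.
rewrite /split_factor ifT //.
rewrite -ltnS ltn_divLR ?expn_gt0 // mul2n -addnn add1n.
by rewrite (leq_ltn_trans (ltn_ord c)) // -[X in (X < _)%N]addn0 ltn_add2l expn_gt0.
Qed.

Definition binomial_sign (R : pzRingType) n : R := (-1) ^+ ((n * (n - 1)) %/ 2).

Lemma binomial_sign_double (R : pzRingType) m :
  binomial_sign R (m + m) = (-1) ^+ m.
Proof.
rewrite /binomial_sign addnn -muln2 mulnAC mulnK // -signr_odd oddM -[RHS]signr_odd.
by case: m => // m; rewrite oddB ?muln_gt0 // oddM andbF andbT.
Qed.

Lemma binomial_signM (R : comPzRingType) m :
  binomial_sign R m * binomial_sign R m.+1 = (-1) ^+ m.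
Proof.
have -> : binomial_sign R m.+1 = binomial_sign R m * (-1) ^+ m.
  rewrite /binomial_sign -exprD subn1 /=; congr (_ ^+ _).
  by rewrite addnC -divnMDl //; congr (_ %/ _)%N; case: m => // m; nia.
by rewrite mulrA /binomial_sign -expr2 sqrr_sign mul1r.
Qed.

Lemma binomial_sign_doubleS (R : pzRingType) m :
  binomial_sign R (m + 1 + m) = (-1) ^+ m.
Proof.
rewrite /binomial_sign addnAC addnK addnn -muln2 mulnA mulnK //.
by rewrite -signr_odd oddM addn1 /= muln2 odd_double signr_odd.
Qed.

(** * The determinant as a product over all halvings *)

(** Determinant and adjugate sum must be treated together; the common factor makes
the recursion polynomial, so that no weight has to be invertible. *)
Lemma hankel_det_split (R : idomainType) (w : nat -> R) N n :
  (0 < n)%N -> (n <= 2 ^ N)%N ->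
  let H := hankel (fun k => carry_diff w (logn 2 k.+1)) n n in
  \det H = binomial_sign R n * w (logn 2 n) * split_prod w N n /\
  adj_sum H = binomial_sign R n * 2 ^+ logn 2 n * split_prod w N n.
Proof.
have case1 M u : let H := hankel (fun k => carry_diff u (logn 2 k.+1)) 1 1 in
    \det H = binomial_sign R 1 * u (logn 2 1) * split_prod u M 1 /\
    adj_sum H = binomial_sign R 1 * 2 ^+ logn 2 1 * split_prod u M 1.
  rewrite /= split_prod1 logn1 /adj_sum !big_ord1 det_mx11 !mxE /cofactor det_mx00.
  by rewrite logn1 /carry_diff big_ord0 subr0 !expr0 !mulr1 mul1r.
elim: N => [|N IHN] in w n *.
  by rewrite expn0; case: n => // [[|//]] _ _; exact: case1.
case: (n =P 1%N) => [-> _ _|n_neq1]; first exact: case1.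
move=> n_gt0 le_n /=.
pose m := n./2; pose w' := next_weight w.
pose a k := carry_diff w (logn 2 k.+1).
have a_even k : a k.*2 = w 0%N.
  by rewrite /a logn2_odd /= ?odd_double // /carry_diff big_ord0 subr0.
have a_odd p q : hankel (fun k => a k.*2.+1) p q =
    hankel (fun k => carry_diff w' (logn 2 k.+1)) p q.
  apply/matrixP=> i j; rewrite !mxE /a -doubleS logn2_double //.
  by rewrite carry_diffS.
have m_gt0 : (0 < m)%N by rewrite /m; lia.
have le_m : (m <= 2 ^ N)%N by move: le_n; rewrite expnS /m; lia.
have [D_m E_m] := IHN w' m m_gt0 le_m.
set v := logn 2 m in D_m E_m; set Q := split_prod w' N m in D_m E_m.
have sg2 : binomial_sign R m ^+ 2 = 1 by rewrite sqrr_sign.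
have [odd_n|even_n] := boolP (odd n).
  have En : n = m.*2.+1 by rewrite /m; lia.
  have le_mS : (m.+1 <= 2 ^ N)%N by move: le_n; rewrite En expnS; lia.
  have [D_mS E_mS] := IHN w' m.+1 isT le_mS.
  set vS := logn 2 m.+1 in D_mS E_mS.
  set QS := split_prod w' N m.+1 in D_mS E_mS.
  rewrite En split_prod_doubleS logn2_odd /= ?odd_double // -/Q -/QS.
  have -> : m.*2.+1 = (m + 1 + m)%N by lia.
  rewrite (det_hankel_doubleS a_even) (adj_sum_hankel_doubleS _ a_even).
  have F2 : hankel_minor (fun k => a k.*2.+1) m ^+ 2 =
      split_factor w 0 (m + 1 + m) * (Q * QS).
    rewrite hankel_minor_sqr !a_odd D_m E_m D_mS E_mS.
    have -> : binomial_sign R m * w' v * Q * (binomial_sign R m.+1 * 2 ^+ vS * QS) -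
        binomial_sign R m.+1 * w' vS * QS * (binomial_sign R m * 2 ^+ v * Q) =
        binomial_sign R m * binomial_sign R m.+1 *
        (w' v * 2 ^+ vS - w' vS * 2 ^+ v) * (Q * QS) by ring.
    rewrite binomial_signM; congr (_ * _).
    have -> : split_factor w 0 (m + 1 + m) = w (v + vS).+1 - 2 ^+ (v + vS) * w 1%N.
      have -> : (m + 1 + m)%N = m.*2.+1 by lia.
      rewrite /split_factor /= odd_double uphalf_double lognM // addn0.
      by rewrite ifN // -ltnNge; lia.
    have [odd_m|even_m] := boolP (odd m).
      have v0 : v = 0%N by rewrite /v logn2_odd.
      by rewrite -signr_odd odd_m v0 /w' /next_weight add0n; ring.
    have vS0 : vS = 0%N by rewrite /vS logn2_odd /= ?even_m.
    by rewrite -signr_odd (negbTE even_m) vS0 /w' /next_weight addn0; ring.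
  by rewrite F2 binomial_sign_doubleS expr0; split; ring.
have En : n = m.*2 by rewrite /m; lia.
rewrite En split_prod_double logn2_double // -/v -/Q.
have -> : split_factor w 0 m.*2 = w v.+1 - 2 ^+ v.+1 * w 0%N.
  rewrite /split_factor odd_double logn2_double // -/v addn0.
  by rewrite ifN // -ltnNge; lia.
have -> : m.*2 = (m + m)%N by lia.
rewrite (det_hankel_double a_even) (adj_sum_hankel_double _ a_even).
rewrite !a_odd D_m E_m binomial_sign_double /w' /next_weight exprS.
move: sg2; set sg := binomial_sign R m => sg2.
(* The two signs of the half-sized problem cancel. *)
split.
- transitivity ((-1) ^+ m * sg ^+ 2 *
    ((w v.+1 - 2 * 2 ^+ v * w 0%N) * w v.+1 * Q ^+ 2)); first by ring.
  by rewrite sg2; ring.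
transitivity ((-1) ^+ m * sg ^+ 2 *
    (2 * 2 ^+ v * (w v.+1 - 2 * 2 ^+ v * w 0%N) * Q ^+ 2)); first by ring.
by rewrite sg2; ring.
Qed.

(** * Run decomposition of the binary expansion *)

Definition binval (bs : seq bool) : nat :=
  foldl (fun v (b : bool) => (b + v.*2)%N) 0%N bs.

Lemma binval_rcons bs b : binval (rcons bs b) = (b + (binval bs).*2)%N.
Proof. by rewrite /binval foldl_rcons. Qed.

(** In this form appending zeros and appending ones follow the same rule. *)
Lemma binval_cat_nseq bs b k :
  (binval (bs ++ nseq k b) + b = (binval bs + b) * 2 ^ k)%N.
Proof.
elim: k => [|k IHk]; first by rewrite cats0 expn0 muln1.
have -> : nseq k.+1 b = rcons (nseq k b) b.
  by rewrite -cats1 -[[:: b]]/(nseq 1 b) -nseqD addn1.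
rewrite -rcons_cat binval_rcons expnS.
move: IHk; set v := binval _; set x := (2 ^ k)%N; set z := (_ + _)%N => IHk.
by rewrite mulnCA -IHk; lia.
Qed.

Lemma binval_binary_digits n : binval (binary_digits n) = n.
Proof.
rewrite /binary_digits; have : (n < 2 ^ (trunc_log 2 n).+1)%N by exact: trunc_log_ltn.
move: (trunc_log 2 n).+1 => N; elim: N n => [|N IHN] n lt_n.
  by move: lt_n; rewrite expn0 ltnS leqn0 => /eqP ->.
rewrite /= -[1%N]addn0 iotaDl rev_cons map_rcons binval_rcons.
rewrite -map_rev -map_comp.
have -> : [seq (bit n \o addn 1) j | j <- rev (iota 0 N)] =
    [seq bit n./2 j | j <- rev (iota 0 N)].
  by apply: eq_map => j /=; rewrite add1n bitS.
rewrite IHN; last by move: lt_n; rewrite expnS; lia.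
by rewrite /bit expn0 divn1 odd_double_half.
Qed.

Definition run_digit s i : bool := odd i == odd s.

(** The number of binary digits up to the end of run i. It equals k_i for i >= 2 but
l_1 + 1 for i = 1, since it also counts the separated digit 1. *)
Definition run_end (l : nat -> nat) i : nat := (1 + \sum_(1 <= j < i.+1) l j)%N.

(** The quotient of the whole number by 2^(run_end l i), read off the runs
above run i. *)
Definition prefix_val s l i : nat :=
  binval (flatten [seq nseq (l k) (run_digit s k) | k <- rev (iota i.+1 (s - i))]).

(** The distance from n to a multiple of 2^(run_end l i): the nearest one below if run
i consists of zeros, above if it consists of ones ([prefix_val_split]). For
i >= 2 it counts, at every position inside run i, the pieces of n that are not
multiples of the power of 2 reaching to the end of the run. *)
Fixpoint run_offset (l : nat -> nat) i : nat :=
  if i is i'.+1 then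
    if i' is 0 then 2 ^ l 1 else 2 ^ run_end l i' - run_offset l i'
  else 0.

Lemma run_digitS s i : run_digit s i.+1 = ~~ run_digit s i.
Proof. by rewrite /run_digit /=; case: (odd i); case: (odd s). Qed.

Lemma run_endS l i : run_end l i.+1 = (run_end l i + l i.+1)%N.
Proof. by rewrite /run_end big_nat_recr //= addnA. Qed.

Lemma run_end1 l : run_end l 1 = (l 1).+1.
Proof. by rewrite /run_end big_nat1. Qed.

Lemma run_posE l i : run_pos l i.+2 = run_end l i.+2.
Proof. by []. Qed.

Lemma prefix_val_last s l : prefix_val s l s = 0%N.
Proof. by rewrite /prefix_val subnn. Qed.

Lemma prefix_valS s l i : (i < s)%N ->
  (prefix_val s l i + run_digit s i.+1 =
    (prefix_val s l i.+1 + run_digit s i.+1) * 2 ^ l i.+1)%N.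
Proof.
move=> lt_is; rewrite /prefix_val -(subnSK lt_is) /= rev_cons map_rcons.
by rewrite flatten_rcons binval_cat_nseq.
Qed.

Lemma run_string_val s l : (0 < s)%N ->
  binval (run_string s l) = ((prefix_val s l 1).*2.+1 * 2 ^ l 1)%N.
Proof.
move=> s_gt0; rewrite /run_string -cat_rcons.
have := binval_cat_nseq (rcons (flatten [seq nseq (l i) (run_digit s i)
  | i <- rev (iota 2 s.-1)]) true) false (l 1).
by rewrite !addn0 binval_rcons /prefix_val subn1.
Qed.

Lemma run_offsetSS l i :
  run_offset l i.+2 = (2 ^ run_end l i.+1 - run_offset l i.+1)%N.
Proof. by []. Qed.

Lemma run_offset_bounds l i :
  (0 < run_offset l i.+1)%N && (run_offset l i.+1 < 2 ^ run_end l i.+1)%N.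
Proof.
elim: i => [|i /andP[IHgt0 IHlt]].
  by rewrite run_end1 /= expn_gt0 ltn_exp2l /=.
rewrite run_offsetSS subn_gt0 IHlt andTb (run_endS l i.+1).
have : (2 ^ run_end l i.+1 <= 2 ^ (run_end l i.+1 + l i.+2))%N.
  by rewrite leq_exp2l // leq_addr.
lia.
Qed.

Lemma run_offsetD l i :
  (run_offset l i.+2 + run_offset l i.+1 = 2 ^ run_end l i.+1)%N.
Proof. by have := run_offset_bounds l i; rewrite run_offsetSS; lia. Qed.

Lemma run_offsetS_le l i :
  (0 < i)%N -> (run_offset l i.+1 <= 2 ^ run_end l i)%N.
Proof. by case: i => // i _; rewrite -run_offsetD leq_addr. Qed.

Section Runs.
Variables (s : nat) (l : nat -> nat) (n : nat).
Hypothesis l_gt0 : forall i, (2 <= i <= s)%N -> (0 < l i)%N.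
Hypothesis n_val : n = ((prefix_val s l 1).*2.+1 * 2 ^ l 1)%N.

(** The last digit of the prefix belongs to the run above and so differs from the
digit of run i; the leading run has the empty prefix 0 above it. *)
Lemma odd_prefix_val i : (0 < i <= s)%N ->
  odd (prefix_val s l i + run_digit s i).
Proof.
move=> /andP[i_gt0]; rewrite leq_eqVlt => /orP[/eqP->|lt_is].
  by rewrite prefix_val_last /run_digit eqxx.
have := congr1 odd (prefix_valS l lt_is); rewrite oddM oddX !oddD.
have -> : (l i.+1 == 0)%N = false by have := @l_gt0 i.+1; lia.
by rewrite run_digitS andbF; case: (odd _); case: run_digit.
Qed.

(** For i = 1 both forms hold, n being an odd multiple of 2^(l_1). *)
Lemma prefix_val_split i : (0 < i <= s)%N ->
  if run_digit s i then
    (n + run_offset l i = (prefix_val s l i).+1 * 2 ^ run_end l i)%N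
  else n = (prefix_val s l i * 2 ^ run_end l i + run_offset l i)%N.
Proof.
case: i => // i; elim: i => [_|i IHi lt_is].
  rewrite n_val run_end1 expnS /=; move: (prefix_val _ _ _) (2 ^ _)%N => p e.
  by case: ifP => _; lia.
have {IHi} := IHi (ltnW lt_is); have := prefix_valS l lt_is.
rewrite (run_digitS s i.+1) (run_endS l i.+1) expnD (run_digitS s i).
have := run_offsetD l i.
set x := prefix_val s l i.+1; set y := prefix_val s l i.+2.
set r := run_offset l i.+1; set r' := run_offset l i.+2.
set e := (2 ^ run_end _ _)%N; set z := (2 ^ l _)%N => Er.
case: run_digit => /=; rewrite ?addn0 ?addn1 => Ex En.
  have -> : (y.+1 * (e * z) = x.+1 * e)%N by rewrite Ex; ring.
  by rewrite mulSn; lia.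
have -> : (y * (e * z) = x * e)%N by rewrite Ex; ring.
by move: En; rewrite mulSn; lia.
Qed.

End Runs.

(** * The factors contributed by a run *)

(** The contribution of all the pieces after t halvings. *)
Definition level_prod (R : comPzRingType) (w : nat -> R) n t : R :=
  \prod_(c < 2 ^ t) split_factor w t ((n + c) %/ 2 ^ t).

Lemma level_prodE (R : comPzRingType) (w : nat -> R) t q r :
  (r <= 2 ^ t)%N ->
  level_prod w (q * 2 ^ t + r) t =
    split_factor w t q ^+ (2 ^ t - r) * split_factor w t q.+1 ^+ r.
Proof.
move=> le_r; rewrite /level_prod.
rewrite -(big_mkord xpredT (fun c => split_factor w t ((q * 2 ^ t + r + c) %/ 2 ^ t))).
have t_gt0 : (0 < 2 ^ t)%N by rewrite expn_gt0.
move: (2 ^ t)%N le_r t_gt0 => m le_r m_gt0.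
rewrite (big_cat_nat (n := m - r)) ?leq_subr //=; congr (_ * _).
  rewrite (eq_big_nat _ _ (F2 := fun _ => split_factor w t q)) ?prodr_const_nat
    ?subn0 //.
  move=> c lt_c; congr split_factor.
  by rewrite -addnA divnMDl // divn_small ?addn0 //; lia.
rewrite (eq_big_nat _ _ (F2 := fun _ => split_factor w t q.+1)) ?prodr_const_nat.
  by rewrite subKn.
move=> c lt_c; congr split_factor.
have -> : (q * m + r + c = q.+1 * m + (r + c - m))%N by rewrite mulSn; lia.
by rewrite divnMDl // divn_small ?addn0 //; lia.
Qed.

Lemma logn2_shift u k : odd u -> logn 2 (u * 2 ^ k) = k.
Proof.
move=> odd_u; have u_gt0 := odd_gt0 odd_u.
by rewrite lognM ?expn_gt0 // logn2_odd // pfactorK.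
Qed.

(** The number divisible by 2^k is y or y + 1 according to b; the other is odd. *)
Lemma logn2_consecutive (b : bool) u k y : odd u -> (0 < k)%N -> (0 < y)%N ->
  (y + b = u * 2 ^ k)%N -> logn 2 (y * y.+1) = k.
Proof.
move=> odd_u k_gt0 y_gt0 Ey; rewrite lognM //.
have := congr1 odd Ey; rewrite oddD oddM oddX [(k == 0)%N]eqn0Ngt k_gt0 andbF.
case: b Ey; rewrite ?addn1 ?addn0 => Ey odd_y.
  by rewrite Ey logn2_shift // logn2_odd //; case: (odd y) odd_y.
by rewrite [logn 2 y.+1]logn2_odd ?Ey ?logn2_shift ?addn0 //= -Ey; case: (odd y) odd_y.
Qed.

Lemma split_factor_even (R : pzRingType) (w : nat -> R) t u k :
  odd u -> (0 < k)%N ->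
  split_factor w t (u * 2 ^ k) = w (k + t)%N - 2 ^+ k * w t.
Proof.
move=> odd_u k_gt0; rewrite /split_factor logn2_shift //.
rewrite oddM oddX [(k == 0)%N]eqn0Ngt k_gt0 andbF ifN // -ltnNge.
case: k k_gt0 => // k _; rewrite expnS mulnCA mul2n -addnn.
by have := expn_gt0 2 k; have := odd_gt0 odd_u; nia.
Qed.

Lemma split_factor_odd (R : pzRingType) (w : nat -> R) t (b : bool) u k y :
  odd u -> (0 < k)%N -> (0 < y)%N -> (y + b = u * 2 ^ k)%N ->
  split_factor w t y.*2.+1 = w (k.+1 + t)%N - 2 ^+ k * w t.+1.
Proof.
move=> odd_u k_gt0 y_gt0 Ey; rewrite /split_factor /= odd_double uphalf_double.
by rewrite (logn2_consecutive odd_u k_gt0 y_gt0 Ey) ifN // -ltnNge; lia.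
Qed.

(** Inside a run of digit b the pieces are u 2^j and its odd neighbour 2y + 1, which
is u 2^j - 1 for b = 1 and u 2^j + 1 for b = 0; the latter occurs r times. *)
Lemma level_prod_run (R : comPzRingType) (w : nat -> R) n (b : bool) u j t r y :
    odd u -> (0 < j)%N -> (r <= 2 ^ t)%N -> (y + b = u * 2 ^ j.-1)%N ->
    (if b then n + r = u * 2 ^ (j + t) else n = u * 2 ^ (j + t) + r)%N ->
  level_prod w n t = (w (j + t)%N - 2 ^+ j * w t) ^+ (2 ^ t - r) *
    split_factor w t y.*2.+1 ^+ r.
Proof.
move=> odd_u j_gt0 le_r Ey En.
have Ex : (y + b).*2 = (u * 2 ^ j)%N.
  by rewrite Ey -{2}(prednK j_gt0) expnS -muln2; ring.
rewrite -(split_factor_even _ _ odd_u j_gt0) -Ex.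
case: b Ey En Ex => Ey En Ex; rewrite expnD mulnA -Ex in En.
  have -> : n = (y.*2.+1 * 2 ^ t + (2 ^ t - r))%N.
    by move: En; rewrite addn1 doubleS mulSn; lia.
  by rewrite level_prodE ?leq_subr // subKn // addn1 doubleS mulrC.
by rewrite En level_prodE // addn0.
Qed.

Lemma prod_nat_rev1 (R : comPzRingType) (F : nat -> R) a p :
  \prod_(a <= t < a + p) F t = \prod_(1 <= j < p.+1) F (a + p - j)%N.
Proof.
rewrite -{1}[a]add0n [X in \prod_(_ <= _ < X) _]addnC big_addn addnK.
rewrite big_nat_rev big_add1 /= big_nat [RHS]big_nat.
by apply: eq_bigr => t /andP[_ lt_t]; congr F; lia.
Qed.

Definition run_factor (R : pzRingType) (w : nat -> R) (l : nat -> nat) i j : R :=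
  w (run_pos l i) - 2 ^+ j * w (run_pos l i - j)%N.

(** The exponents alpha as natural numbers; the recursive case of the last exponent
becomes twice the offset of the previous run. *)
Definition run_exponent (l : nat -> nat) i j : nat :=
  (if j < l i then 2 ^ (run_pos l i - j)
  else if i is i'.+2 then 2 * run_offset l i'.+1 else 1)%N.

Section RunProduct.
Variables (R : comPzRingType) (w : nat -> R) (s : nat) (l : nat -> nat) (n : nat).
Hypothesis l_gt0 : forall i, (2 <= i <= s)%N -> (0 < l i)%N.
Hypothesis n_val : n = ((prefix_val s l 1).*2.+1 * 2 ^ l 1)%N.

Let next_top i : R := if (i < s)%N then run_factor w l i.+1 (l i.+1) else 1.

(** At the top digit of run i the odd neighbour is 2p + 1 with p the prefix above, and
one of p, p + 1 is an odd multiple of a power of 2 whose exponent is the length of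
the next run. *)
Lemma split_factor_prefix i t : (0 < i <= s)%N -> t.+1 = run_end l i ->
  split_factor w t (prefix_val s l i).*2.+1 = next_top i.
Proof.
move=> /andP[i_gt0 le_is] Et; rewrite /next_top.
move: le_is; rewrite leq_eqVlt => /orP[/eqP->|lt_is].
  by rewrite ltnn prefix_val_last /split_factor.
have odd_u : odd (prefix_val s l i.+1 + run_digit s i.+1).
  by apply: odd_prefix_val; rewrite ?lt_is.
have l_i : (0 < l i.+1)%N by apply: l_gt0; lia.
have p_gt0 : (0 < prefix_val s l i)%N.
  have := prefix_valS l lt_is; have := odd_gt0 odd_u.
  have : (1 < 2 ^ l i.+1)%N by rewrite -{1}(expn0 2) ltn_exp2l.
  by move: (2 ^ _)%N (_ + _)%N => x z; case: run_digit => /=; nia.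
rewrite lt_is (split_factor_odd w t odd_u l_i p_gt0 (prefix_valS l lt_is)).
rewrite /run_factor; case: i i_gt0 Et {p_gt0 l_i odd_u lt_is} => // i _ Et.
rewrite run_posE (run_endS l i.+1) -Et addnK.
by congr (w _ - _); lia.
Qed.

Lemma level_prod_first t : (t < l 1)%N ->
  level_prod w n t = run_factor w l 1 (l 1 - t) ^+ (2 ^ t).
Proof.
move=> lt_t.
have -> : n = ((prefix_val s l 1).*2.+1 * 2 ^ (l 1 - t) * 2 ^ t + 0)%N.
  by rewrite addn0 -mulnA -expnD subnK 1?ltnW.
rewrite level_prodE // subn0 expr0 mulr1 split_factor_even ?subn_gt0 //=.
  by rewrite /run_factor /run_pos eqxx subKn 1?ltnW // subnK 1?ltnW.
by rewrite odd_double.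
Qed.

Lemma level_prod_first_one : (0 < s)%N ->
  level_prod w n (l 1) = next_top 1 ^+ run_offset l 1.
Proof.
move=> s_gt0; rewrite n_val -[X in level_prod w X]addn0 level_prodE //.
rewrite expr0 mulr1 subn0 (@split_factor_prefix 1) ?run_end1 //.
Qed.

Lemma level_prod_next i j : (0 < i < s)%N -> (0 < j <= l i.+1)%N ->
  level_prod w n (run_end l i.+1 - j) =
    run_factor w l i.+1 j ^+ (2 ^ (run_end l i.+1 - j) - run_offset l i.+1) *
    (if (1 < j)%N then run_factor w l i.+1 j.-1 else next_top i.+1)
      ^+ run_offset l i.+1.
Proof.
move=> /andP[i_gt0 lt_is] /andP[j_gt0 le_j].
have posE : run_pos l i.+1 = run_end l i.+1 by case: i i_gt0 {lt_is le_j}.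
set K := run_end l i.+1; set t := (K - j)%N; set r := run_offset l i.+1.
have le_jK : (j <= K)%N by rewrite /K run_endS (leq_trans le_j) // leq_addl.
have Kt : (j + t)%N = K by rewrite subnKC.
set b := run_digit s i.+1; set u := (prefix_val s l i.+1 + b)%N.
have odd_u : odd u by apply: odd_prefix_val; rewrite ?lt_is.
have le_r : (r <= 2 ^ t)%N.
  have : (2 ^ run_end l i <= 2 ^ t)%N.
    by rewrite leq_exp2l // /t /K run_endS; lia.
  exact/leq_trans/run_offsetS_le.
have le_bu : (b <= u * 2 ^ j.-1)%N.
  by rewrite (leq_trans (leq_b1 b)) // muln_gt0 odd_gt0 // expn_gt0.
set y := (u * 2 ^ j.-1 - b)%N.
have Ey : (y + b = u * 2 ^ j.-1)%N by rewrite subnK.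
have En : (if b then n + r = u * 2 ^ (j + t) else n = u * 2 ^ (j + t) + r)%N.
  have := @prefix_val_split s l n n_val i.+1; rewrite lt_is => /(_ isT).
  by rewrite Kt /u -/b; case: (b) => /=; rewrite ?addn1 ?addn0.
rewrite (level_prod_run w odd_u j_gt0 le_r Ey En) Kt /run_factor posE -/K -/t.
congr (_ * _ ^+ _); case: ifP => [j_gt1|j_le1].
  rewrite (@split_factor_odd _ w t b u j.-1 y) //; first last.
  - have : (1 < 2 ^ j.-1)%N by rewrite -{1}(expn0 2) ltn_exp2l //; lia.
    have pos (x c z : nat) : (0 < z)%N -> (c <= 1)%N -> (1 < x)%N -> (0 < z * x - c)%N.
      by nia.
    by apply: pos (leq_b1 b); exact: odd_gt0.
  - by lia.
  by congr (w _ - _ * w _); lia.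
have j1 : j = 1%N by lia.
have -> : y = prefix_val s l i.+1 by rewrite /y j1 /= expn0 muln1 /u addnK.
by apply: split_factor_prefix; rewrite ?lt_is // -/K; lia.
Qed.

(** Consecutive positions of a run share a factor: the odd neighbours at position j + 1
restore the exponent of the factor j to the full power of 2. *)
Lemma level_prods_run m i : (0 < i < s)%N -> (0 < m <= l i.+1)%N ->
  \prod_(1 <= j < m.+1) level_prod w n (run_end l i.+1 - j) =
  next_top i.+1 ^+ run_offset l i.+1 *
  run_factor w l i.+1 m ^+ (2 ^ (run_end l i.+1 - m) - run_offset l i.+1) *
  \prod_(1 <= j < m) run_factor w l i.+1 j ^+ (2 ^ (run_end l i.+1 - j)).
Proof.
move=> i_bd; elim: m => // m IHm /andP[_ lt_m].
case: m IHm lt_m => [|m] IHm lt_m.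
  by rewrite big_nat1 level_prod_next // big_geq // mulr1 mulrC.
rewrite big_nat_recr //= IHm ?(ltnW lt_m) // level_prod_next //=.
rewrite [in RHS]big_nat_recr //=.
set K := run_end l i.+1; set r := run_offset l i.+1.
have le_r : (r <= 2 ^ (K - m.+1))%N.
  have : (2 ^ run_end l i <= 2 ^ (K - m.+1))%N.
    by rewrite leq_exp2l // /K run_endS; lia.
  by apply/leq_trans/run_offsetS_le; case/andP: i_bd.
have -> : run_factor w l i.+1 m.+1 ^+ (2 ^ (K - m.+1)) =
    run_factor w l i.+1 m.+1 ^+ (2 ^ (K - m.+1) - r) * run_factor w l i.+1 m.+1 ^+ r.
  by rewrite -exprD subnK.
ring.
Qed.

(** The factor left over at the top of run i completes the exponent of the last factor
of run i + 1. *)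
Lemma level_prods i : (0 < i <= s)%N ->
  \prod_(0 <= t < run_end l i) level_prod w n t =
  (\prod_(1 <= i' < i.+1) \prod_(1 <= j < (l i').+1)
     run_factor w l i' j ^+ run_exponent l i' j) *
  next_top i ^+ run_offset l i.
Proof.
case: i => // i; elim: i => [s_gt0|i IHi /andP[_ lt_is]].
  rewrite run_end1 big_nat_recr //= level_prod_first_one // big_nat1; congr (_ * _).
  rewrite big_nat_rev big_add1 /= big_nat [RHS]big_nat add0n.
  apply: eq_bigr => j /andP[_ lt_j].
  rewrite level_prod_first; last by rewrite ltn_subrL (leq_ltn_trans _ lt_j).
  rewrite subKn //.
  congr (_ ^+ _); rewrite /run_exponent /run_pos eqxx; case: ifP => // le_l.
  have -> : l 1%N = j.+1 by apply/eqP; rewrite eqn_leq lt_j leqNgt le_l.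
  by rewrite subnn.
have le_end : (run_end l i.+1 <= run_end l i.+2)%N.
  by rewrite (run_endS l i.+1) leq_addr.
rewrite (big_cat_nat (leq0n _) le_end) /=.
rewrite IHi ?(ltnW lt_is) // [in RHS]big_nat_recr //=.
have l_i : (0 < l i.+2)%N by apply: l_gt0; rewrite lt_is.
have -> : \prod_(run_end l i.+1 <= t < run_end l i.+2) level_prod w n t =
    \prod_(1 <= j < (l i.+2).+1) level_prod w n (run_end l i.+2 - j).
  by rewrite (run_endS l i.+1); exact: prod_nat_rev1.
rewrite level_prods_run ?lt_is ?l_i ?leqnn // {1}/next_top lt_is.
rewrite [X in _ = _ * X * _]big_nat_recr //=.
set K := run_end l i.+2; set r := run_offset l i.+1; set r' := run_offset l i.+2.
have -> : (2 ^ (K - l i.+2) - r' = r)%N.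
  by rewrite /K (run_endS l i.+1) addnK -(run_offsetD l i) addKn.
have -> : run_exponent l i.+2 (l i.+2) = (r + r)%N.
  by rewrite /run_exponent ltnn addnn -mul2n.
have -> : \prod_(1 <= j < l i.+2) run_factor w l i.+2 j ^+ (2 ^ (K - j)) =
    \prod_(1 <= j < l i.+2) run_factor w l i.+2 j ^+ run_exponent l i.+2 j.
  rewrite big_nat [RHS]big_nat; apply: eq_bigr => j /andP[_ lt_j].
  by rewrite /run_exponent lt_j.
rewrite exprD; ring.
Qed.

End RunProduct.

(** * Exponents *)

Lemma last_exponentE l i :
  last_exponent l i.+2 = (2 * run_offset l i.+1)%:Z.
Proof.
have base : 2 ^+ (l 1%N).+1 = (2 * 2 ^ l 1%N)%:Z.
  by rewrite -expnS -natz natrX.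
elim/ltn_ind: i => [[|[|i]]] IHi.
- exact: base.
- have -> : run_offset l 2 = (2 ^ l 1)%N.
    by rewrite run_offsetSS run_end1 expnS mul2n -addnn /= addnK.
  exact: base.
have -> : last_exponent l i.+4 = 2 ^+ (run_pos l i.+2).+1 - last_exponent l i.+3.
  by [].
rewrite IHi // run_posE.
have -> : 2 ^+ (run_end l i.+2).+1 = (2 * 2 ^ run_end l i.+2)%:Z.
  by rewrite -expnS -natz natrX.
by rewrite -(run_offsetD l i.+1) mulnDr PoszD addrK.
Qed.

Lemma exponentE l i j : (0 < i)%N -> exponent l i j = (run_exponent l i j)%:Z.
Proof.
move=> i_gt0; rewrite /exponent /run_exponent; case: ifP => _.
  by rewrite -natz natrX.
by case: i i_gt0 => [|[|i]] // _; exact: last_exponentE.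
Qed.

Lemma run_exponent_gt0 l i j : (0 < run_exponent l i j)%N.
Proof.
rewrite /run_exponent; case: ifP => _; first by rewrite expn_gt0.
case: i => [|[|i]] //; rewrite muln_gt0 /=.
by have /andP[] := run_offset_bounds l i.
Qed.

Lemma run_exponent_decr l i j1 j2 : (0 < i)%N -> (j1 < j2 <= l i)%N ->
  (run_exponent l i j2 < run_exponent l i j1)%N.
Proof.
move=> i_gt0 /andP[lt_j le_j2].
have lt_j1 : (j1 < l i)%N by exact: leq_trans lt_j le_j2.
have le_pos : (l i <= run_pos l i)%N.
  case: i i_gt0 {lt_j1 le_j2} => [|[|i]] // _.
  by rewrite run_posE run_endS leq_addl.
rewrite /run_exponent lt_j1; case: ifP => [lt_j2|_].
  by rewrite ltn_exp2l //; lia.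
case: i i_gt0 lt_j1 {le_j2 le_pos} => [|[|i]] // _ lt_j1.
  by rewrite /run_pos eqxx -{1}(expn0 2) ltn_exp2l // subn_gt0.
have /andP[_ lt_sc] := run_offset_bounds l i.
apply: (@leq_trans (2 ^ (run_end l i.+1).+1)).
  by rewrite expnS ltn_pmul2l.
by rewrite leq_exp2l // run_posE (run_endS l i.+1); lia.
Qed.

Lemma sum_exp2_down k m : (m <= k)%N ->
  (\sum_(1 <= j < m.+1) 2 ^ (k - j) + 2 ^ (k - m) = 2 ^ k)%N.
Proof.
elim: m => [|m IHm] lt_mk; first by rewrite big_geq // subn0.
rewrite big_nat_recr //= -addnA addnn -mul2n -expnS subnSK //.
exact: IHm (ltnW lt_mk).
Qed.

Lemma sum_run_exponent s l i :
    (forall i', (2 <= i' <= s)%N -> (0 < l i')%N) -> (0 < i <= s)%N ->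
  (1 + \sum_(1 <= i' < i.+1) \sum_(1 <= j < (l i').+1) run_exponent l i' j
     + run_offset l i = 2 ^ run_end l i)%N.
Proof.
move=> l_gt0; case: i => // i; elim: i => [_|i IHi /andP[_ lt_is]].
  rewrite big_nat1 run_end1 expnS mul2n -addnn /=; congr (_ + _)%N.
  rewrite -[RHS](sum_exp2_down (leqnn _)) subnn expn0 addnC; congr (_ + _)%N.
  rewrite big_nat [RHS]big_nat; apply: eq_bigr => j /andP[_ le_j].
  rewrite /run_exponent /run_pos eqxx; case: ifP => // ge_j.
  have -> : j = l 1%N by apply/eqP; rewrite eqn_leq -ltnS le_j leqNgt ge_j.
  by rewrite subnn.
have l_i : (0 < l i.+2)%N by apply: l_gt0; rewrite lt_is.
have := run_offsetD l i; set r' := run_offset l i.+2 => Er'.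
rewrite big_nat_recr //= addnA [X in (_ + X + _)%N]big_nat_recr //=.
move: (IHi (ltnW lt_is)); set S := (1 + _)%N => ES.
have -> : run_exponent l i.+2 (l i.+2) = (2 * run_offset l i.+1)%N.
  by rewrite /run_exponent ltnn.
set K := run_end l i.+2.
have -> : (\sum_(1 <= j < l i.+2) run_exponent l i.+2 j =
    \sum_(1 <= j < l i.+2) 2 ^ (K - j))%N.
  rewrite big_nat [RHS]big_nat; apply: eq_bigr => j /andP[_ lt_j].
  by rewrite /run_exponent lt_j.
have KE : K = (run_end l i.+1 + l i.+2)%N by rewrite /K (run_endS l i.+1).
have := @sum_exp2_down K (l i.+2).-1; rewrite prednK //.
have -> : (K - (l i.+2).-1 = (run_end l i.+1).+1)%N by rewrite KE; lia.
rewrite expnS => /(_ _) <-; last by rewrite KE; lia.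
by lia.
Qed.

Lemma exprz_exponent (R : unitRingType) (x : R) l i j : (0 < i)%N ->
  x ^ exponent l i j = x ^+ run_exponent l i j.
Proof. by move=> i_gt0; rewrite exponentE // exprnP. Qed.

Theorem theorem3p4 (R : realType) (w : nat -> R[i]) (n : nat) (n_gt0 : (0 < n)%N)
    (s : nat) (l : nat -> nat) (s_gt0 : (0 < s)%N)
    (l_gt0 : forall i : nat, (2 <= i <= s)%N -> (0 < l i)%N)
    (n_bin : binary_digits n = run_string s l) :
  [/\ hankel_det w n =
        (-1) ^+ ((n * (n - 1)) %/ 2) * w (l 1%N) *
        \prod_(1 <= i < s.+1) \prod_(1 <= j < (l i).+1)
          (w (run_pos l i) - 2 ^+ j * w (run_pos l i - j)%N) ^ exponent l i j,
      forall i j : nat, (1 <= i <= s)%N -> (1 <= j <= l i)%N ->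
        0 < exponent l i j,
      forall i j1 j2 : nat, (1 <= i <= s)%N ->
        (1 <= j1)%N -> (j1 < j2)%N -> (j2 <= l i)%N ->
        exponent l i j2 < exponent l i j1
    & 1 + \sum_(1 <= i < s.+1) \sum_(1 <= j < (l i).+1) exponent l i j = n%:Z].
Proof.
have n_val : n = ((prefix_val s l 1).*2.+1 * 2 ^ l 1%N)%N.
  by rewrite -(run_string_val _ s_gt0) -n_bin binval_binary_digits.
have s_bd : (0 < s <= s)%N by rewrite s_gt0 leqnn.
have n_top : (n + run_offset l s = 2 ^ run_end l s)%N.
  have := prefix_val_split n_val s_bd.
  by rewrite /run_digit eqxx prefix_val_last mul1n.
split.
- have [] := @hankel_det_split _ w (run_end l s) n n_gt0.
    by rewrite -n_top leq_addr.
  have -> : logn 2 n = l 1%N by rewrite n_val logn2_shift //= odd_double.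
  have -> : hankel (fun k => carry_diff w (logn 2 k.+1)) n n =
      \matrix_(i < n, j < n) digit_diff w (i + j)%N.
    by apply/matrixP=> i j; rewrite !mxE digit_diffE.
  rewrite /hankel_det => -> _; congr (_ * _).
  rewrite /split_prod -(big_mkord xpredT (level_prod w n)).
  rewrite (level_prods w l_gt0 n_val s_bd) ltnn expr1n mulr1.
  rewrite big_nat [RHS]big_nat; apply: eq_bigr => i /andP[i_gt0 _].
  by apply: eq_bigr => j _; rewrite exprz_exponent.
- move=> i j /andP[i_gt0 _] _; rewrite exponentE // ltz_nat.
  exact: run_exponent_gt0.
- move=> i j1 j2 /andP[i_gt0 _] _ lt_j le_j2; rewrite !exponentE // ltz_nat.
  by apply: run_exponent_decr; rewrite ?lt_j.
have sumE : \sum_(1 <= i < s.+1) \sum_(1 <= j < (l i).+1) exponent l i j =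
    (\sum_(1 <= i < s.+1) \sum_(1 <= j < (l i).+1) run_exponent l i j)%N%:Z.
  rewrite -natz natr_sum; apply: eq_big_nat => i /andP[i_gt0 _].
  by rewrite natr_sum; apply: eq_bigr => j _; rewrite exponentE // natz.
have := sum_run_exponent l_gt0 s_bd.
by rewrite sumE -n_top => /addIn <-; rewrite PoszD.
Qed.
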